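(* Let $f$ be a homeomorphism of a metric space $X$, let $V$ be a Banach space, and let $\mathcal{A}$ be a continuous Banach cocycle over $f$ with values in $GL(V)$, generated by $A:X\to GL(V)$ (write $\mathcal{A}_x=A(x)$). If the set of values $\mathcal{A}_X=\{\mathcal{A}_x^n: x\in X,\ n\in\mathbb{Z}\}$ has compact closure in $(GL(V),d)$, then there exists a bounded Borel measurable family of norms $\|\cdot\|_x$, $x\in X$, on $V$ such that $\mathcal{A}_x:(V,\|\cdot\|_x)\to(V,\|\cdot\|_{fx})$ is an isometry for each $x\in X$.
   Context: $V$ is a Banach space with norm $\|\cdot\|$; $GL(V)$ is the group of invertible bounded linear operators on $V$, with the metric $d(A,B)=\|A-B\|+\|A^{-1}-B^{-1}\|$ (operator norms). The Banach cocycle over $f$ generated by a function $A:X\to(GL(V),d)$ is given by $\mathcal{A}_x^0=\mathrm{Id}$ and, for $n\in\mathbb{N}=\{1,2,\dots\}$, $\mathcal{A}_x^n=A(f^{n-1}x)\circ\cdots\circ A(x)$ and $\mathcal{A}_x^{-n}=(\mathcal{A}_{f^{-n}x}^n)^{-1}$. It is continuous if $A:X\to(GL(V),d)$ is continuous. Let $N$ be the set of norms on $V$ equivalent to $\|\cdot\|$, with the metric $$\mathrm{dist}(\varphi_1,\varphi_2)=\log\min\{t\ge 1: t^{-1}\varphi_2(v)\le\varphi_1(v)\le t\varphi_2(v)\ \text{for all } v\in V\}.$$ A family of norms $\|\cdot\|_x$, $x\in X$, is bounded if there is a constant $K>0$ with $K^{-1}\|v\|\le\|v\|_x\le K\|v\|$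 for all $v\in V$, $x\in X$; it is Borel measurable if the map $x\mapsto\|\cdot\|_x$ from $X$ to $(N,\mathrm{dist})$ is Borel measurable. *)

(* Defs.v *)
From HB Require Import structures.
From mathcomp Require Import all_boot all_order all_algebra.
From mathcomp Require Import all_classical all_reals all_analysis.
From mathcomp Require Import complex.

Set Implicit Arguments.
Unset Strict Implicit.
Unset Printing Implicit Defensive.

Import Order.TTheory GRing.Theory Num.Theory.
Import numFieldNormedType.Exports.

Local Open Scope classical_set_scope.
Local Open Scope ring_scope.

(* A Banach space is real or complex.  In the library the norm of a normed
   module over K takes its values in K, so over R[i] the real number meant by
   `|v| is the real part of `|v|. *)
Inductive scalars := RealScalars | ComplexScalars.

Definition scalar_field (R : realType) (s : scalars) : numFieldType :=
  match s with RealScalars => R | ComplexScalars => (R[i])%C end.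

Definition real_part (R : realType) (s : scalars) : scalar_field R s -> R :=
  match s with RealScalars => fun x => x | ComplexScalars => @complex.Re R end.

Section RealNorm.
Context {R : realType} {s : scalars}.
Implicit Types x y a : scalar_field R s.

Definition rabs x : R := real_part `|x|.

Lemma real_partD x y : real_part (x + y) = real_part x + real_part y.
Proof. by case: s x y => //= -[? ?] [? ?]. Qed.

Lemma real_part_ge0 x : 0 <= x -> 0 <= real_part x.
Proof. by case: s x => //= -[u v]; rewrite lecE => /andP[]. Qed.

Lemma real_part_le x y : x <= y -> real_part x <= real_part y.
Proof. by case: s x y => //= -[? ?] [? ?]; rewrite lecE => /andP[]. Qed.

Lemma real_part_eq0 x : 0 <= x -> real_part x = 0 -> x = 0.
Proof.
by case: s x => //= -[u v]; rewrite lecE /= => /andP[/eqP -> _] ->.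
Qed.

Lemma real_partM x y : 0 <= x -> real_part (x * y) = real_part x * real_part y.
Proof.
case: s x y => //= -[u v] [p q]; rewrite lecE /= => /andP[/eqP v0 _].
by rewrite v0 mul0r subr0.
Qed.

Context {V : normedModType (scalar_field R s)}.
Implicit Types u v w : V.

Definition rnorm v : R := real_part `|v|.

Lemma rnorm_ge0 v : 0 <= rnorm v. Proof. exact: real_part_ge0. Qed.

Lemma rnormD u v : rnorm (u + v) <= rnorm u + rnorm v.
Proof. by rewrite -real_partD; apply/real_part_le/ler_normD. Qed.

Lemma rnormN v : rnorm (- v) = rnorm v. Proof. by rewrite /rnorm normrN. Qed.

Lemma rnormZ a v : rnorm (a *: v) = rabs a * rnorm v.
Proof. by rewrite /rnorm normrZ real_partM. Qed.

Lemma rnorm0 : rnorm 0 = 0.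
Proof. by rewrite /rnorm normr0; case: s. Qed.

Lemma rnorm_eq0 v : rnorm v = 0 -> v = 0.
Proof. by move/real_part_eq0 => /(_ (normr_ge0 _))/normr0_eq0. Qed.

(* [V -> V] and not [{linear V -> V}]: this is applied to differences. *)
Definition bounded_op (T : V -> V) : Prop :=
  exists c : R, forall v, rnorm (T v) <= c * rnorm v.

Definition opnorm (T : V -> V) : R :=
  inf [set c : R | 0 <= c /\ forall v, rnorm (T v) <= c * rnorm v].

Lemma bounded_op_ge0 T : bounded_op T ->
  [set c : R | 0 <= c /\ forall v, rnorm (T v) <= c * rnorm v] !=set0.
Proof.
move=> [c cT]; exists (Num.max 0 c); split => [|v]; first by rewrite le_max lexx.
by rewrite (le_trans (cT v))// ler_wpM2r ?rnorm_ge0// le_max lexx orbT.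
Qed.

Lemma opnorm_ge0 T : 0 <= opnorm T.
Proof.
rewrite /opnorm; have [->|/set0P S0] := eqVneq
  [set c : R | 0 <= c /\ forall v, rnorm (T v) <= c * rnorm v] set0.
  by rewrite inf0.
by apply: lb_le_inf => // c [].
Qed.

Lemma opnorm_bound T v : bounded_op T -> rnorm (T v) <= opnorm T * rnorm v.
Proof.
move=> /bounded_op_ge0 S0.
have [v0|vN0] := eqVneq (rnorm v) 0.
  have [c [_ /(_ v)]] := S0; by rewrite v0 !mulr0.
have v_gt0 : 0 < rnorm v by rewrite lt_neqAle eq_sym vN0 rnorm_ge0.
rewrite -ler_pdivrMr//; apply: lb_le_inf => // c [_ cT].
by rewrite ler_pdivrMr.
Qed.

Lemma opnorm_le T c : 0 <= c -> (forall v, rnorm (T v) <= c * rnorm v) ->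
  opnorm T <= c.
Proof. by move=> c0 cT; apply: ge_inf => //; exists 0 => d []. Qed.

End RealNorm.

Section GL.
Context {R : realType} {s : scalars}.
Variable V : normedModType (scalar_field R s).

Record GL := MkGL {
  gl_fun :> {linear V -> V} ;
  gl_invfun : {linear V -> V} ;
  gl_bounded : bounded_op gl_fun ;
  gl_inv_bounded : bounded_op gl_invfun ;
  gl_funK : cancel gl_fun gl_invfun ;
  gl_invfunK : cancel gl_invfun gl_fun }.

End GL.

Section GLTheory.
Context {R : realType} {s : scalars} {V : normedModType (scalar_field R s)}.
Implicit Types A B C : GL V.

Lemma linear_ext (S T : {linear V -> V}) : S =1 T -> S = T.
Proof.
case: S => S [[S0] [S1]]; case: T => T [[T0] [T1]] /= /funext ST; subst T.
by rewrite (Prop_irrelevance S0 T0) (Prop_irrelevance S1 T1).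
Qed.

Lemma GL_ext A B : A =1 B -> A = B.
Proof.
case: A B => [S S' bS bS' SK S'K] [T T' bT bT' TK T'K] /= ST.
have S'T' : S' =1 T' by move=> v; rewrite -{1}(T'K v) -ST SK.
move: bS bS' SK S'K; rewrite (linear_ext ST) (linear_ext S'T') => *.
by congr MkGL; exact: Prop_irrelevance.
Qed.

Lemma bounded_op_id : bounded_op (@idfun V).
Proof. by exists 1 => v; rewrite mul1r. Qed.

Lemma bounded_op_comp (S T : V -> V) :
  bounded_op S -> bounded_op T -> bounded_op (S \o T).
Proof.
move=> bS /bounded_op_ge0[d [d0 dT]]; have [c [c0 cS]] := bounded_op_ge0 bS.
exists (c * d) => v; rewrite (le_trans (cS _))// -mulrA ler_wpM2l//; exact: dT.
Qed.

Lemma bounded_op_sub (S T : V -> V) :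
  bounded_op S -> bounded_op T -> bounded_op (S \- T).
Proof.
move=> [c cS] [d dT]; exists (c + d) => v /=.
by rewrite mulrDl (le_trans (rnormD _ _))// rnormN lerD.
Qed.

HB.instance Definition _ := gen_eqMixin (GL V).
HB.instance Definition _ := gen_choiceMixin (GL V).

Definition gl_one : GL V :=
  MkGL (gl_fun := idfun) (gl_invfun := idfun) bounded_op_id bounded_op_id
    (fun=> erefl) (fun=> erefl).

Definition gl_inv A : GL V :=
  MkGL (gl_inv_bounded A) (gl_bounded A) (@gl_invfunK _ _ _ A)
    (@gl_funK _ _ _ A).

Definition gl_mul A B : GL V :=
  MkGL (gl_fun := A \o B) (gl_invfun := gl_invfun B \o gl_invfun A)
    (bounded_op_comp (gl_bounded A) (gl_bounded B))
    (bounded_op_comp (gl_inv_bounded B) (gl_inv_bounded A))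
    (can_comp (@gl_funK _ _ _ A) (@gl_funK _ _ _ B))
    (can_comp (@gl_invfunK _ _ _ B) (@gl_invfunK _ _ _ A)).

Lemma gl_mulA : associative gl_mul.
Proof. by move=> A B C; exact: GL_ext. Qed.
Lemma gl_mul1 : left_id gl_one gl_mul.
Proof. by move=> A; exact: GL_ext. Qed.
Lemma gl_mulr1 : right_id gl_one gl_mul.
Proof. by move=> A; exact: GL_ext. Qed.
Lemma gl_mulV : left_inverse gl_one gl_inv gl_mul.
Proof. by move=> A; apply: GL_ext => v /=; rewrite gl_funK. Qed.
Lemma gl_mulrV : right_inverse gl_one gl_inv gl_mul.
Proof. by move=> A; apply: GL_ext => v /=; rewrite gl_invfunK. Qed.

HB.instance Definition _ := isGroup.Build (GL V)
  gl_mulA gl_mul1 gl_mulr1 gl_mulV gl_mulrV.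

Definition gl_dist A B : R :=
  opnorm (A \- B) + opnorm (gl_invfun A \- gl_invfun B).

Lemma opnorm_subxx (T : V -> V) : opnorm (T \- T) = 0.
Proof.
apply/eqP; rewrite eq_le opnorm_ge0 andbT; apply: opnorm_le => // v /=.
by rewrite subrr rnorm0 mul0r.
Qed.

Lemma opnorm_subC (S T : V -> V) : opnorm (S \- T) = opnorm (T \- S).
Proof.
rewrite /opnorm; congr inf; apply/seteqP; split=> c [c0 cT]; split=> // v;
  by move: (cT v); rewrite /= -rnormN opprB.
Qed.

Lemma opnorm_sub_triangle (T S U : V -> V) : bounded_op S -> bounded_op T ->
  bounded_op U -> opnorm (S \- U) <= opnorm (S \- T) + opnorm (T \- U).
Proof.
move=> bS bT bU; apply: opnorm_le => [|v]; first by rewrite addr_ge0// opnorm_ge0.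
rewrite mulrDl /= -(subrKA (T v)) (le_trans (rnormD _ _))//.
by rewrite lerD//; apply: (opnorm_bound (T := _ \- _)); exact: bounded_op_sub.
Qed.

Lemma gl_distxx A : gl_dist A A = 0.
Proof. by rewrite /gl_dist !opnorm_subxx addr0. Qed.

Lemma gl_dist_eq0 A B : gl_dist A B = 0 -> A = B.
Proof.
move/eqP; rewrite paddr_eq0 ?opnorm_ge0// => /andP[/eqP AB0 _].
apply: GL_ext => v; apply/subr0_eq/rnorm_eq0/eqP.
rewrite eq_le rnorm_ge0 andbT -[leRHS](mul0r (rnorm v)) -AB0.
apply: (opnorm_bound (T := A \- B)).
by apply: bounded_op_sub; exact: gl_bounded.
Qed.

Lemma gl_distC A B : gl_dist A B = gl_dist B A.
Proof. by rewrite /gl_dist opnorm_subC [X in _ + X]opnorm_subC. Qed.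

Lemma gl_dist_triangle B A C : gl_dist A C <= gl_dist A B + gl_dist B C.
Proof.
rewrite /gl_dist addrACA lerD// opnorm_sub_triangle//;
  by [exact: gl_bounded | exact: gl_inv_bounded].
Qed.

HB.instance Definition _ :=
  isMetric.Build R (GL V) gl_distxx gl_dist_eq0 gl_distC gl_dist_triangle.

End GLTheory.

Section EquivalentNorms.
Context {R : realType} {s : scalars}.
Variable V : normedModType (scalar_field R s).

Definition is_norm (phi : V -> R) : Prop :=
  [/\ forall u v, phi (u + v) <= phi u + phi v,
      forall a v, phi (a *: v) = rabs a * phi v &
      forall v, phi v = 0 -> v = 0].

Definition equivalent_to_norm (phi : V -> R) : Prop :=
  exists2 c : R, 0 < c & forall v, c^-1 * rnorm v <= phi v <= c * rnorm v.

Record eqnorm := MkEqnorm {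
  eqnorm_fun :> V -> R ;
  eqnorm_is_norm : is_norm eqnorm_fun ;
  eqnorm_equiv : equivalent_to_norm eqnorm_fun }.

End EquivalentNorms.

Section EquivalentNormsTheory.
Context {R : realType} {s : scalars} {V : normedModType (scalar_field R s)}.
Implicit Types phi psi chi : eqnorm V.

HB.instance Definition _ := gen_eqMixin (eqnorm V).
HB.instance Definition _ := gen_choiceMixin (eqnorm V).

Lemma eqnorm_ext phi psi : phi =1 psi -> phi = psi.
Proof.
case: phi psi => [p np ep] [q nq eq] /= /funext pq.
by subst q; congr MkEqnorm; exact: Prop_irrelevance.
Qed.

Lemma eqnorm_ge0 phi v : 0 <= phi v.
Proof.
have [c c0 /(_ v)/andP[+ _]] := eqnorm_equiv phi; apply: le_trans.
by rewrite mulr_ge0 ?rnorm_ge0// invr_ge0 ltW.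
Qed.

Definition norm_ratios phi psi : set R :=
  [set t | 1 <= t /\ forall v, t^-1 * psi v <= phi v <= t * psi v].

Definition norm_dist phi psi : R := ln (inf (norm_ratios phi psi)).

Lemma norm_ratiosP phi psi t : 1 <= t ->
  norm_ratios phi psi t <->
  (forall v, psi v <= t * phi v) /\ (forall v, phi v <= t * psi v).
Proof.
move=> t1; have t0 : 0 < t by rewrite (lt_le_trans _ t1).
split=> [[_ H]|[H1 H2]].
  by split=> v; have /andP[] := H v; rewrite ?ler_pdivrMl.
by split=> // v; rewrite ler_pdivrMl// H1 H2.
Qed.

Lemma norm_ratios_neq0 phi psi : norm_ratios phi psi !=set0.
Proof.
have [c c0 cP] := eqnorm_equiv phi; have [d d0 dP] := eqnorm_equiv psi.
exists (1 + c * d).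
have cd0 : 0 <= c * d by rewrite mulr_ge0 ?ltW.
have t1 : 1 <= 1 + c * d by rewrite lerDl.
apply/norm_ratiosP => //; split=> v; move: (cP v) (dP v); rewrite !ler_pdivrMl//.
- move=> /andP[pc _] /andP[_ pd]; rewrite mulrDl mul1r.
  rewrite ler_wpDl ?eqnorm_ge0// (le_trans pd)// mulrC (mulrC c) -mulrA.
  by rewrite mulrC ler_wpM2l// ltW.
- move=> /andP[_ pc] /andP[pd _]; rewrite mulrDl mul1r.
  rewrite ler_wpDl ?eqnorm_ge0// (le_trans pc)// -mulrA.
  by rewrite ler_wpM2l// ltW.
Qed.

Lemma norm_ratios_lb phi psi : has_lbound (norm_ratios phi psi).
Proof. by exists 1 => t []. Qed.

Lemma norm_ratios_inf_ge1 phi psi : 1 <= inf (norm_ratios phi psi).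
Proof. by apply: lb_le_inf => [|t []//]; exact: norm_ratios_neq0. Qed.

(* The infimum in norm_dist is a minimum. *)
Lemma norm_ratios_inf phi psi :
  norm_ratios phi psi (inf (norm_ratios phi psi)).
Proof.
apply/norm_ratiosP; first exact: norm_ratios_inf_ge1.
have key (p q : R) : 0 <= q -> (forall t, norm_ratios phi psi t -> p <= t * q) ->
    p <= inf (norm_ratios phi psi) * q.
  move=> q0 H; have [qz|qN0] := eqVneq q 0.
    by have [t /H] := norm_ratios_neq0 phi psi; rewrite qz !mulr0.
  have q_gt0 : 0 < q by rewrite lt_neqAle eq_sym qN0.
  rewrite -ler_pdivrMr//; apply: lb_le_inf; first exact: norm_ratios_neq0.
  by move=> t /H; rewrite ler_pdivrMr.
split=> v; apply: key => [|t rt]; rewrite ?eqnorm_ge0//;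
  by have [t1 _] := rt; have [] := (norm_ratiosP _ _ t1).1 rt.
Qed.

Lemma norm_distP phi psi (t : R) : 1 <= t ->
  norm_dist phi psi <= ln t <-> norm_ratios phi psi t.
Proof.
move=> t1; have t0 : 0 < t by rewrite (lt_le_trans _ t1).
have i0 : 0 < inf (norm_ratios phi psi).
  by rewrite (lt_le_trans _ (norm_ratios_inf_ge1 _ _)).
rewrite /norm_dist ler_ln ?posrE//; split=> [it|rt]; last first.
  by apply: ge_inf => //; exact: norm_ratios_lb.
have := norm_ratios_inf phi psi.
move=> /(norm_ratiosP _ _ (norm_ratios_inf_ge1 _ _))[H1 H2].
apply/norm_ratiosP => //; split=> v.
  by rewrite (le_trans (H1 v))// ler_wpM2r// eqnorm_ge0.
by rewrite (le_trans (H2 v))// ler_wpM2r// eqnorm_ge0.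
Qed.

Lemma norm_dist_ge0 phi psi : 0 <= norm_dist phi psi.
Proof. exact/ln_ge0/norm_ratios_inf_ge1. Qed.

Lemma norm_distxx phi : norm_dist phi phi = 0.
Proof.
apply/eqP; rewrite eq_le norm_dist_ge0 andbT -ln1.
by apply/norm_distP => //; split=> // v; rewrite invr1 mul1r lexx.
Qed.

Lemma norm_dist_eq0 phi psi : norm_dist phi psi = 0 -> phi = psi.
Proof.
move=> d0; have : norm_dist phi psi <= ln 1 by rewrite d0 ln1.
move=> /norm_distP -/(_ (lexx _))[_ H]; apply: eqnorm_ext => v.
by apply/eqP; rewrite eq_le andbC; move: (H v); rewrite invr1 !mul1r.
Qed.

Lemma norm_distC phi psi : norm_dist phi psi = norm_dist psi phi.
Proof.
rewrite /norm_dist; congr (ln (inf _)).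
by apply/seteqP; split=> t rt; have [t1 _] := rt;
  have [? ?] := (norm_ratiosP _ _ t1).1 rt; apply/norm_ratiosP.
Qed.

Lemma norm_dist_triangle psi phi chi :
  norm_dist phi chi <= norm_dist phi psi + norm_dist psi chi.
Proof.
have a1 := norm_ratios_inf_ge1 phi psi; have b1 := norm_ratios_inf_ge1 psi chi.
have a0 := lt_le_trans ltr01 a1; have b0 := lt_le_trans ltr01 b1.
rewrite {2 3}/norm_dist -lnM ?posrE//.
have ab1 : 1 <= inf (norm_ratios phi psi) * inf (norm_ratios psi chi).
  by rewrite -[leLHS]mulr1 ler_pM.
apply/norm_distP => //; apply/norm_ratiosP => //.
have /(norm_ratiosP _ _ a1)[A1 A2] := norm_ratios_inf phi psi.
have /(norm_ratiosP _ _ b1)[B1 B2] := norm_ratios_inf psi chi.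
split=> v.
  by rewrite (le_trans (B1 v))// -mulrA mulrCA ler_pM2l.
by rewrite (le_trans (A2 v))// -mulrA ler_pM2l.
Qed.

HB.instance Definition _ := isMetric.Build R (eqnorm V)
  norm_distxx norm_dist_eq0 norm_distC norm_dist_triangle.

End EquivalentNormsTheory.

Definition homeomorphism (X : topologicalType) (f finv : X -> X) : Prop :=
  [/\ cancel f finv, cancel finv f, continuous f & continuous finv].

Section Cocycle.
Context {R : realType} {s : scalars} {V : normedModType (scalar_field R s)}.
Context {X : Type}.
Variables (f finv : X -> X) (A : X -> GL V).

Fixpoint cocycle_nat (n : nat) (x : X) : GL V :=
  if n is m.+1 then (A (iter m f x) * cocycle_nat m x)%g else 1%g.

(* Negz m is the integer - m.+1. *)
Definition cocycle (n : int) (x : X) : GL V :=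
  match n with
  | Posz m => cocycle_nat m x
  | Negz m => ((cocycle_nat m.+1 (iter m.+1 finv x))^-1)%g
  end.

Definition cocycle_values : set (GL V) :=
  [set B | exists x n, B = cocycle n x].

End Cocycle.

(* The library's measurable functions live on pointed types, while X may be
   empty and eqnorm V has no distinguished point. *)
Definition borel_measurable (X Y : topologicalType) (h : X -> Y) : Prop :=
  forall B : set Y, <<s open >> B -> <<s open >> (h @^-1` B).

Section NormFamilies.
Context {R : realType} {s : scalars} {V : normedModType (scalar_field R s)}.

Definition bounded_family (X : Type) (nu : X -> eqnorm V) : Prop :=
  exists2 c : R, 0 < c &
    forall x v, c^-1 * rnorm v <= nu x v <= c * rnorm v.

Definition norm_isometry (phi psi : eqnorm V) (T : V -> V) : Prop :=
  forall v, psi (T v) = phi v.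

End NormFamilies.

(* Main.v *)
(** The norm is [||v||_x = sup_n ||A_x^n v||].  Compactness of the closure of
    the cocycle values makes it uniformly equivalent to [||v||], and invariance
    is the shift [n -> n + 1].  For measurability, the norms
    [max_(|n| <= N) ||A_x^n v||] depend continuously on [x] as elements of
    [(N, dist)]; by total boundedness of the orbit [{A_x^n : n}], they converge
    in [dist] to [||.||_x], and a pointwise limit of continuous maps into a
    metric space is Borel. *)
Require Import Defs.
From mathcomp Require Import all_boot all_order all_algebra.
From mathcomp Require Import all_classical all_reals all_analysis.

Import Order.TTheory GRing.Theory Num.Theory.
Import numFieldNormedType.Exports.

Local Open Scope classical_set_scope.
Local Open Scope ring_scope.

(** * Borel measurability of pointwise limits *)

Section BorelLimits.
Set Implicit Arguments.
Unset Strict Implicit.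

Lemma borel_measurable_open (X Y : topologicalType) (h : X -> Y) :
  (forall U, open U -> <<s open >> (h @^-1` U)) -> borel_measurable h.
Proof.
move=> hU B sB.
have sI := sigma_algebra_image h (@smallest_sigma_algebra _ [set: X] open).
have := smallest_sub sI _ sB; rewrite /image_set_system/= setTI; apply.
by move=> U oU /=; rewrite setTI; exact: hU.
Qed.

Lemma metric_open_ball (R : realType) (Y : metricType R) (y : Y) (r : R) :
  open (ball y r).
Proof.
rewrite openE => z; rewrite ballEmdist /= => yz; apply/nbhs_ballP.
exists (r - mdist y z) => /=; first by rewrite subr_gt0.
move=> w; rewrite !ballEmdist /= ltrBrDl; exact/le_lt_trans/metric_triangle.
Qed.

(** For open [U], the points whose ball of radius 1/(k+1) lies in [U] form a closed set [inner k],
    and [h x] is in [U] iff for some k the sequence [g n x] eventually stays in [inner k]. *)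
Lemma borel_measurable_cvg (R : realType) (X : topologicalType)
    (Y : metricType R) (g : nat -> X -> Y) (h : X -> Y) :
  (forall n, continuous (g n)) -> (forall x, g ^~ x @ \oo --> h x) ->
  borel_measurable h.
Proof.
move=> cg gh; apply: borel_measurable_open => U oU.
pose inner k : set Y := [set y | ball y k.+1%:R^-1 `<=` U].
have o_inner k : open (~` inner k).
  have -> : ~` inner k = \bigcup_(z in ~` U) ball z (k.+1%:R^-1 : R).
    apply/seteqP; split=> [y /existsNP[z /not_implyP[yz Uz]]|y [z Uz zy] yU].
      by exists z => //; exact: ball_sym.
    by apply/Uz/yU/ball_sym.
  by apply: bigcup_open => z _; exact: metric_open_ball.
(* The intersection over m is written as the complement of a union of open preimages, so that
   countable unions and complements suffice. *)
have -> : h @^-1` U =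
    \bigcup_k \bigcup_N ~` \bigcup_m (g (N + m)%N @^-1` (~` inner k)).
  apply/seteqP; split=> [x /= Uhx|x [k _ [N _ gx]] /=].
    have /nbhs_ballP[_/posnumP[e] eU] : nbhs (h x) U by exact: open_nbhs_nbhs.
    (* With 1/(k+1) < e/2, the ball tested by [inner k] around a term that close to [h x] stays
       within e of [h x]. *)
    have [k _ /(_ _ (leqnn k)) ke] :=
      near_infty_natSinv_lt (e%:num / 2)%:pos.
    have k0 : 0 < k.+1%:R^-1 :> R by rewrite invr_gt0.
    have [N _ Ng] := cvg_ball (gh x) k0.
    exists k => //; exists N => // -[m _]; apply => z /(ball_triangle _) gz.
    apply: eU; have := gz _ _ (Ng (N + m)%N (leq_addr _ _)).
    by apply: le_ball; rewrite [leRHS]splitr lerD// ltW.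
  have k0 : 0 < k.+1%:R^-1 :> R by rewrite invr_gt0.
  have [N' _ Ng] := cvg_ball (gh x) k0.
  (* The index N + N' is late enough both for [inner k] and for closeness to [h x]. *)
  have : inner k (g (N + N')%N x).
    by apply: contrapT => nx; apply: gx; exists N'.
  by apply; apply/ball_sym/Ng; exact: leq_addl.
apply: sigma_algebra_bigcup => k; apply: sigma_algebra_bigcup => N.
rewrite -setTD; apply: sigma_algebraCD; apply: sigma_algebra_bigcup => m.
apply: sub_sigma_algebra; apply: open_comp => // x _; exact: cg.
Qed.

End BorelLimits.

(** * Uniform indices from compactness *)

Section Compactness.
Set Implicit Arguments.
Unset Strict Implicit.

(** Each point has a neighborhood inside some [U m], hence inside all later ones; the near-covering
    form of compactness, for the filter of large n, makes the index uniform. *)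
Lemma compact_nondecreasing_cover (T : topologicalType) (K : set T)
    (U : nat -> set T) : compact K -> (forall n, open (U n)) ->
  (forall m n, (m <= n)%N -> U m `<=` U n) -> K `<=` \bigcup_n U n ->
  exists n, K `<=` U n.
Proof.
move=> /compact_near_coveringP Kc oU UU KU.
have [x /KU[m _ Umx]|N _ NU] := Kc nat \oo U _; last first.
  by exists N; apply: NU => /=.
exists (U m, [set n | (m <= n)%N]) => /=.
  by split; [exact: open_nbhs_nbhs|exists m].
by move=> [y n] /= [Uy mn]; exact: UU Uy.
Qed.

(** Total boundedness, with the net taken from a symmetric window of indices. The e-neighborhoods of
    the windows increase with N and cover the closure, since every e-ball about a point of the
    closure meets the range. *)
Lemma compact_int_net (R : realType) (M : metricType R) (u : int -> M) (e : R) :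
  compact (closure (range u)) -> 0 < e ->
  exists N, forall i, exists2 j, (`|j| <= N)%N & mdist (u j) (u i) < e.
Proof.
move=> Kc e0; pose U N := \bigcup_(j in [set j : int | (`|j| <= N)%N]) ball (u j) e.
have [|m n mn x [j jm xj]||N KU] := compact_nondecreasing_cover (U := U) Kc.
- by move=> n; apply: bigcup_open => j _; exact: metric_open_ball.
- by exists j => //=; exact: leq_trans mn.
- move=> x /(_ _ (nbhsx_ballx x e e0))[_ [[j _ <-] xj]].
  by exists `|j|%N => //; exists j => //=; exact: ball_sym.
exists N => i; have [|j jN] := KU (u i); first by apply: subset_closure; exists i.
by rewrite ballEmdist; exists j.
Qed.

Lemma compact_mdist_bounded (R : realType) (M : metricType R) (K : set M) (x : M) :
  compact K -> exists2 c : R, 0 <= c & forall y, K y -> mdist x y <= c.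
Proof.
move=> Kc; pose U n := ball x (n%:R : R).
have [|m n mn||n KU] := compact_nondecreasing_cover (U := U) Kc.
- by move=> n; exact: metric_open_ball.
- by apply: le_ball; rewrite ler_nat.
- move=> y _; exists (Num.truncn (mdist x y)).+1 => //.
  by rewrite /U ballEmdist /= truncnS_gt.
by exists n%:R => // y /KU; rewrite /U ballEmdist => /ltW.
Qed.

End Compactness.

(** * Suprema over sets of operators as equivalent norms *)

Section SupNorm.
Set Implicit Arguments.
Unset Strict Implicit.
Context {R : realType} {s : scalars} {V : normedModType (scalar_field R s)}.
Implicit Types (S T : set (GL V)) (v : V).

Definition sup_norm S v : R := sup [set rnorm (B v) | B in S].

(* Containing the identity makes the supremum dominate the original norm. *)
Definition norming S : Prop :=
  S 1%g /\ exists c : R, forall B, S B -> forall v, rnorm (B v) <= c * rnorm v.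

Lemma sup_norm_ge S B v : norming S -> S B -> rnorm (B v) <= sup_norm S v.
Proof.
move=> [_ [c cS]] SB; apply: ub_le_sup; last by exists B.
by exists (c * rnorm v) => _ [C SC <-]; exact: cS.
Qed.

Lemma sup_norm_le S v (r : R) : norming S ->
  (forall B, S B -> rnorm (B v) <= r) -> sup_norm S v <= r.
Proof.
move=> [S1 _] Sr; apply: ge_sup => [|_ [B SB <-]]; last exact: Sr.
by exists (rnorm ((1%g : GL V) v)), 1%g.
Qed.

Lemma sup_norm_ge_rnorm S v : norming S -> rnorm v <= sup_norm S v.
Proof. by move=> nS; have [S1 _] := nS; exact: (sup_norm_ge v nS S1). Qed.

Lemma sup_norm_is_norm S : norming S -> is_norm (sup_norm S).
Proof.
move=> nS; split=> [u v|a v|v v0].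
- apply: sup_norm_le => // B SB; rewrite linearD.
  by rewrite (le_trans (rnormD _ _))// lerD// sup_norm_ge.
- have a0 : 0 <= rabs a by exact: real_part_ge0.
  apply/eqP; rewrite eq_le; apply/andP; split.
    by apply: sup_norm_le => // B SB; rewrite linearZ rnormZ ler_wpM2l// sup_norm_ge.
  (* The reverse inequality divides by [rabs a], so the value 0 is split off. *)
  have [->|aN0] := eqVneq (rabs a) 0.
    by rewrite mul0r (le_trans _ (sup_norm_ge_rnorm _ nS))// rnorm_ge0.
  have a_gt0 : 0 < rabs a by rewrite lt_neqAle eq_sym aN0.
  rewrite -ler_pdivlMl//; apply: sup_norm_le => // B SB.
  by rewrite ler_pdivlMl// -rnormZ -linearZ sup_norm_ge.
- apply: rnorm_eq0; apply/eqP; rewrite eq_le rnorm_ge0 andbT -v0.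
  exact: sup_norm_ge_rnorm.
Qed.

Lemma sup_norm_bounds S (c : R) v : norming S -> 1 <= c ->
  (forall B, S B -> forall v, rnorm (B v) <= c * rnorm v) ->
  c^-1 * rnorm v <= sup_norm S v <= c * rnorm v.
Proof.
move=> nS c1 cS; have c0 := lt_le_trans ltr01 c1; apply/andP; split.
  rewrite (le_trans _ (sup_norm_ge_rnorm v nS))// ler_pdivrMl//.
  by rewrite ler_peMl// rnorm_ge0.
by apply: sup_norm_le => // B SB; exact: cS.
Qed.

Lemma sup_norm_equivalent S : norming S -> equivalent_to_norm (sup_norm S).
Proof.
(* The constant in [norming] carries no sign condition; raising it to at least 1 lets it serve in
   both bounds. *)
move=> nS; have [_ [c cS]] := nS; have c1 : 1 <= Num.max 1 c by rewrite le_max lexx.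
exists (Num.max 1 c) => [|v]; first by rewrite (lt_le_trans ltr01).
apply: sup_norm_bounds => // B SB w; rewrite (le_trans (cS _ SB _))//.
by rewrite ler_wpM2r ?rnorm_ge0// le_max lexx orbT.
Qed.

Definition sup_eqnorm S (nS : norming S) : eqnorm V :=
  MkEqnorm (sup_norm_is_norm nS) (sup_norm_equivalent nS).

(** Replacing [B] by [C] costs at most e times the norm of v, which [sup_norm T v] dominates because
    [T] contains the identity; the additive error thus becomes a factor 1 + e. *)
Lemma sup_norm_perturb S T (e : R) v : norming S -> norming T -> 0 <= e ->
  (forall B, S B -> exists2 C, T C & gl_dist B C <= e) ->
  sup_norm S v <= (1 + e) * sup_norm T v.
Proof.
move=> nS nT e0 ST; apply: sup_norm_le => // B SB; have [C TC BC] := ST _ SB.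
rewrite -[B v](subrK (C v)) (le_trans (rnormD _ _))// addrC mulrDl mul1r.
rewrite lerD ?sup_norm_ge//.
have bBC : bounded_op (B \- C) by apply: bounded_op_sub; exact: gl_bounded.
rewrite (le_trans (opnorm_bound v bBC))// ler_pM ?opnorm_ge0 ?rnorm_ge0//.
  by rewrite (le_trans _ BC)// lerDl opnorm_ge0.
exact: sup_norm_ge_rnorm.
Qed.

(** The sup norm is 1-Lipschitz in the set of operators for the Hausdorff distance, as ln (1 + e) <=
    e. Both continuity in x and convergence in N rest on this. *)
Lemma norm_dist_sup_eqnorm S T (nS : norming S) (nT : norming T) (e : R) :
  0 <= e ->
  (forall B, S B -> exists2 C, T C & gl_dist B C <= e) ->
  (forall C, T C -> exists2 B, S B & gl_dist C B <= e) ->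
  norm_dist (sup_eqnorm nS) (sup_eqnorm nT) <= e.
Proof.
move=> e0 ST TS; rewrite (le_trans (y := ln (1 + e)))//; last first.
  by apply: le_ln1Dx; rewrite (lt_le_trans _ e0)// ltrN10.
have e1 : 1 <= 1 + e by rewrite lerDl.
apply/norm_distP => //; apply/norm_ratiosP => //.
by split=> v; exact: sup_norm_perturb.
Qed.

End SupNorm.

(** * Lipschitz estimates for products in GL(V) *)

Section GLProducts.
Set Implicit Arguments.
Unset Strict Implicit.
Context {R : realType} {s : scalars} {V : normedModType (scalar_field R s)}.
Implicit Types A B : GL V.

(** Write T v = v - (v - T v); the metric controls this difference for the operator and for its
    inverse. *)
Lemma gl_dist1_bound B (c : R) v : gl_dist 1%g B <= c ->
  rnorm (B v) <= (1 + c) * rnorm v /\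
  rnorm (gl_invfun B v) <= (1 + c) * rnorm v.
Proof.
move=> dc.
have key (T : V -> V) : bounded_op T -> opnorm (idfun \- T) <= c ->
    rnorm (T v) <= (1 + c) * rnorm v.
  move=> bT Tc; rewrite -[T v](subKr v) (le_trans (rnormD _ _))//.
  rewrite mulrDl mul1r rnormN lerD//.
  have bT' := bounded_op_sub (@bounded_op_id _ _ V) bT.
  by rewrite (le_trans (opnorm_bound v bT'))// ler_wpM2r ?rnorm_ge0.
split; apply: key; rewrite ?(le_trans _ dc)//.
- exact: gl_bounded.
- by rewrite lerDl opnorm_ge0.
- exact: gl_inv_bounded.
- by rewrite lerDr opnorm_ge0.
Qed.

(** Telescoping: S T - S' T' = (S - S') T' + S (T - T'). *)
Lemma opnorm_comp_sub (S S' T T' : {linear V -> V}) (c : R) : 0 <= c ->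
  bounded_op S -> bounded_op S' -> bounded_op T -> bounded_op T' ->
  (forall v, rnorm (S v) <= c * rnorm v) ->
  (forall v, rnorm (T' v) <= c * rnorm v) ->
  opnorm ((S \o T) \- (S' \o T')) <= c * (opnorm (S \- S') + opnorm (T \- T')).
Proof.
move=> c0 bS bS' bT bT' Sc T'c.
apply: opnorm_le => [|v /=]; first by rewrite mulr_ge0// addr_ge0// opnorm_ge0.
have -> : S (T v) - S' (T' v) = (S \- S') (T' v) + S ((T \- T') v).
  by rewrite /= linearB [RHS]addrC subrKA.
rewrite (le_trans (rnormD _ _))// mulrDr mulrDl lerD//.
  rewrite (le_trans (opnorm_bound _ (bounded_op_sub bS bS')))//.
  by rewrite (mulrC c) -mulrA ler_wpM2l// opnorm_ge0.
rewrite (le_trans (Sc _))// -mulrA ler_wpM2l//.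
exact: (opnorm_bound _ (bounded_op_sub bT bT')).
Qed.

Lemma gl_dist_mul (A A' B B' : GL V) (c : R) : 0 <= c ->
  gl_dist 1%g A <= c -> gl_dist 1%g B <= c ->
  gl_dist 1%g A' <= c -> gl_dist 1%g B' <= c ->
  gl_dist (A * B)%g (A' * B')%g <= (1 + c) * (gl_dist A A' + gl_dist B B').
Proof.
move=> c0 Ac Bc A'c B'c; have c10 : 0 <= 1 + c by rewrite addr_ge0.
rewrite /gl_dist addrACA mulrDr lerD//.
  apply: (@opnorm_comp_sub A A' B B') => //; try exact: gl_bounded.
    by move=> v; have [] := gl_dist1_bound v Ac.
  by move=> v; have [] := gl_dist1_bound v B'c.
(* Inversion reverses the factors, so the two distances trade places. *)
rewrite [X in _ <= _ * X]addrC.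
apply: (@opnorm_comp_sub (gl_invfun B) (gl_invfun B') (gl_invfun A)
  (gl_invfun A')) => //; try exact: gl_inv_bounded.
  by move=> v; have [] := gl_dist1_bound v Bc.
by move=> v; have [] := gl_dist1_bound v A'c.
Qed.

Lemma gl_dist_inv A B : gl_dist (A^-1)%g (B^-1)%g = gl_dist A B.
Proof. by rewrite /gl_dist addrC. Qed.

End GLProducts.

(** * The cocycle, its orbits and the invariant norms *)

Section Cocycle.
Set Implicit Arguments.
Unset Strict Implicit.

Lemma continuous_iter (X : topologicalType) (h : X -> X) n :
  continuous h -> continuous (iter n h).
Proof.
move=> ch; elim: n => [|n IHn] x /=; first exact: cvg_id.
exact: (continuous_comp (IHn x) (ch _)).
Qed.

Context {R : realType} {s : scalars} {V : normedModType (scalar_field R s)}.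
Context {X : metricType R}.
Variables (f finv : X -> X) (A : X -> GL V).

Let orbit x : set (GL V) := range (fun n => cocycle f finv A n x).
Let orbit_trunc N x : set (GL V) :=
  [set cocycle f finv A n x | n in [set n : int | (`|n| <= N)%N]].

(** The recursion adds the latest factor on the left; the shift by [f] requires splitting off the
    earliest one on the right. *)
Lemma cocycle_natS n x :
  cocycle_nat f A n.+1 x = (cocycle_nat f A n (f x) * A x)%g.
Proof.
elim: n => [|n IHn] /=; first by rewrite mulg1 mul1g.
by rewrite -mulgA -IHn -iterSr.
Qed.

Lemma cocycle_shift (finvK : cancel finv f) (fK : cancel f finv) n x :
  (cocycle f finv A n (f x) * A x)%g = cocycle f finv A (n + 1) x.
Proof.
case: n => [n|[|n]]; first by rewrite -PoszD addn1 /cocycle cocycle_natS.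
  by rewrite /= fK mulg1 mulVg.
have -> : Negz n.+1 + 1 = Negz n by rewrite !NegzE -addn1 PoszD opprD subrK.
have iterK m y : iter m f (iter m finv y) = y.
  by elim: m y => // m IHm y; rewrite iterSr /= finvK IHm.
have -> : cocycle f finv A (Negz n.+1) (f x) =
    ((cocycle_nat f A n.+2 (iter n.+1 finv x))^-1)%g.
  by rewrite /cocycle iterSr fK.
(* The leftmost factor sits at f^(n+1) (f^(-n-1) x) = x, so its inverse cancels [A x]. *)
rewrite [cocycle_nat f A n.+2 _]/= -/(cocycle_nat f A n.+1 _).
by rewrite -[f _]/(iter n.+1 f _) iterK invgM -mulgA mulVg mulg1.
Qed.

Hypothesis hf : homeomorphism f finv.
Hypothesis hA : continuous A.
Hypothesis hK : compact (closure (cocycle_values f finv A)).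

Lemma cocycle_bounded : exists2 c : R, 0 <= c &
  forall n x, gl_dist 1%g (cocycle f finv A n x) <= c.
Proof.
have [c c0 cP] := compact_mdist_bounded (1%g : GL V) hK.
by exists c => // n x; apply: cP; apply: subset_closure; exists x, n.
Qed.

Lemma continuous_cocycle_nat n : continuous (cocycle_nat f A n).
Proof.
have [_ _ cf _] := hf; have [c c0 cP] := cocycle_bounded.
elim: n => [|n IHn] x /=; first exact: cvg_cst.
have cA : {for x, continuous (A \o iter n f)}.
  by apply: continuous_comp; [exact: continuous_iter|exact: hA].
(* The generator is the cocycle at time 1, so the same c bounds it. *)
have A_c y : gl_dist 1%g (A y) <= c by rewrite -[A y]mulg1; exact: (cP 1 y).
have n_c y : gl_dist 1%g (cocycle_nat f A n y) <= c by exact: (cP n y).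
(* [gl_dist_mul] multiplies the sum of two distances by 1 + c. *)
apply/cvg_ballP => e e0; have e' : 0 < e / (1 + c) / 2.
  by rewrite !divr_gt0// ltr_wpDr.
near=> y; rewrite ballEmdist /=.
rewrite (le_lt_trans (gl_dist_mul c0 (A_c _) (n_c _) (A_c _) (n_c _)))//.
rewrite -ltr_pdivlMl ?ltr_wpDr// mulrC [ltRHS]splitr ltrD//; near: y.
  exact: cvg_ball cA _ e'.
exact: cvg_ball (IHn x) _ e'.
Unshelve. all: by end_near. Qed.

(** Negative times follow because inversion is an isometry of GL(V) and [finv] is continuous. *)
Lemma continuous_cocycle n : continuous (cocycle f finv A n).
Proof.
have [_ _ _ cfinv] := hf.
case: n => n; first exact: continuous_cocycle_nat.
move=> x; have cn : {for x, continuous (cocycle_nat f A n.+1 \o iter n.+1 finv)}.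
  apply: continuous_comp; first exact: continuous_iter.
  exact: continuous_cocycle_nat.
apply/cvg_ballP => e e0; near=> y; rewrite ballEmdist /= -[mdist _ _]/(gl_dist _ _).
rewrite gl_dist_inv; near: y; exact: cvg_ball cn _ e0.
Unshelve. all: by end_near. Qed.

Lemma norming_sub_orbit x S : S 1%g -> S `<=` orbit x -> norming S.
Proof.
have [c c0 cP] := cocycle_bounded => S1 SO; split => //; exists (1 + c).
by move=> B /SO[n _ <-] v; have [] := gl_dist1_bound v (cP n x).
Qed.

Lemma norming_orbit x : norming (orbit x).
Proof. by apply: (@norming_sub_orbit x) => //; exists 0. Qed.

Lemma norming_orbit_trunc N x : norming (orbit_trunc N x).
Proof.
apply: (@norming_sub_orbit x) => [|_ [n _ <-]]; last by exists n.
by exists 0.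
Qed.

Lemma continuous_sup_orbit_trunc N :
  continuous (fun x => sup_eqnorm (norming_orbit_trunc N x)).
Proof.
move=> x; apply/cvg_ballP => e e0.
have e2 : 0 < e / 2 by rewrite divr_gt0.
(* A finite index type lets finitely many neighborhoods be intersected; each ordinal stands for the
   two times n and -n. *)
have cvgN : \forall y \near x, forall n : 'I_N.+1,
    gl_dist (cocycle f finv A n%:Z x) (cocycle f finv A n%:Z y) < e / 2 /\
    gl_dist (cocycle f finv A (- n%:Z) x) (cocycle f finv A (- n%:Z) y) < e / 2.
  apply: filter_forall => n.
  apply: filterI; first exact: (cvg_ball (@continuous_cocycle n%:Z x) e2).
  exact: (cvg_ball (@continuous_cocycle (- n%:Z) x) e2).
apply: filterS cvgN => y cvgNy.
rewrite ballEmdist /= -[mdist _ _]/(norm_dist _ _).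
have dxy n : (`|n| <= N)%N ->
    gl_dist (cocycle f finv A n x) (cocycle f finv A n y) <= e / 2.
  move=> nN.
  have [m mN [->|->]] : exists2 m : nat, (m < N.+1)%N & n = m%:Z \/ n = - m%:Z.
    exists `|n|%N => //; case: (intP n) => [|m|m]; [by left|by left|right].
      by rewrite abszN.
  - by have [/ltW] := cvgNy (Ordinal mN).
  - by have [_ /ltW] := cvgNy (Ordinal mN).
rewrite (@le_lt_trans _ _ (e / 2))//; last by rewrite ltr_pdivrMr// ltr_pMr// ltr1n.
apply: norm_dist_sup_eqnorm; first exact: ltW.
- by move=> _ [n nN <-]; exists (cocycle f finv A n y); [exists n|exact: dxy].
- move=> _ [n nN <-]; exists (cocycle f finv A n x); first by exists n.
  by rewrite gl_distC; exact: dxy.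
Qed.

(** The closure of one orbit is a closed subset of a compact set, so some truncation is an e/2-net
    of the orbit, and so is every later one. *)
Lemma sup_orbit_trunc_cvg x :
  (fun N => sup_eqnorm (norming_orbit_trunc N x)) @ \oo -->
  sup_eqnorm (norming_orbit x).
Proof.
apply/cvg_ballP => e e0; have e2 : 0 < e / 2 by rewrite divr_gt0.
have Kx : compact (closure (orbit x)).
  apply: subclosed_compact hK _; first exact: closed_closure.
  by apply: closureS => _ [n _ <-]; exists x, n.
have [N NP] := compact_int_net Kx e2.
exists N => // M NM; rewrite ballEmdist /= -[mdist _ _]/(norm_dist _ _).
rewrite (@le_lt_trans _ _ (e / 2))//; last by rewrite ltr_pdivrMr// ltr_pMr// ltr1n.
apply: norm_dist_sup_eqnorm; first exact: ltW.
- move=> _ [n _ <-]; have [m mN mn] := NP n.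
  exists (cocycle f finv A m x); first by exists m => //=; exact: leq_trans NM.
  by rewrite gl_distC; exact: ltW.
- move=> _ [n _ <-]; exists (cocycle f finv A n x); first by exists n.
  by rewrite gl_distxx ltW.
Qed.

(** Since n -> n + 1 is a bijection of the integers, both suprema are taken over the same set. *)
Lemma sup_orbit_isometry x :
  norm_isometry (sup_eqnorm (norming_orbit x)) (sup_eqnorm (norming_orbit (f x)))
    (A x).
Proof.
have [fK finvK _ _] := hf => v; rewrite /= /sup_norm; congr sup.
apply/seteqP; split=> _ [_ [n _ <-] <-].
  exists (cocycle f finv A (n + 1) x); first by exists (n + 1).
  by rewrite -cocycle_shift.
exists (cocycle f finv A (n - 1) (f x)); first by exists (n - 1).
by rewrite -[in RHS](subrK 1 n) -cocycle_shift.
Qed.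

Lemma sup_orbit_bounded : bounded_family (fun x => sup_eqnorm (norming_orbit x)).
Proof.
have [c c0 cP] := cocycle_bounded.
have c1 : 1 <= 1 + c by rewrite lerDl.
exists (1 + c) => [|x v]; first by rewrite (lt_le_trans ltr01).
apply: sup_norm_bounds => //; first exact: norming_orbit.
by move=> _ [n _ <-] w; have [] := gl_dist1_bound w (cP n x).
Qed.

Lemma sup_orbit_borel : borel_measurable (fun x => sup_eqnorm (norming_orbit x)).
Proof.
exact: borel_measurable_cvg continuous_sup_orbit_trunc sup_orbit_trunc_cvg.
Qed.

End Cocycle.

Theorem proposition1p5 (R : realType) (s : scalars)
    (V : completeNormedModType (scalar_field R s))
    (X : metricType R) (f finv : X -> X) (hf : homeomorphism f finv)
    (A : X -> GL V) (hA : continuous A)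
    (hcompact : compact (closure (cocycle_values f finv A))) :
  exists nu : X -> eqnorm V,
    [/\ bounded_family nu,
        borel_measurable nu &
        forall x, norm_isometry (nu x) (nu (f x)) (A x)].
Proof.
exists (fun x => sup_eqnorm (norming_orbit hcompact x)); split.
- exact: sup_orbit_bounded.
- exact: sup_orbit_borel.
- exact: sup_orbit_isometry.
Qed.
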